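(* Let $R$ be a non-associative ring, let $\sigma,\delta:R\to R$ be additive maps with $\sigma(1)=1$ and $\delta(1)=0$, and let $S=R[X;\sigma,\delta]$. If $S$ is simple, then $R$ is $\sigma$-$\delta$-simple.
   Context: A non-associative ring is an additive abelian group with a (not necessarily associative) multiplication that is left and right distributive, and with a multiplicative identity $1$. Ideals are two-sided; a ring is simple if $\{0\}$ and the ring itself are its only ideals. $R[X;\sigma,\delta]$ is the set of formal polynomials $\sum_i r_iX^i$ ($r_i\in R$) with the usual addition and with multiplication the biadditive extension of $aX^m\cdot bX^n=\sum_{i\in\mathbb{N}} a\,\pi_i^m(b)X^{i+n}$, where $\pi_i^m$ is the sum of all $\binom{m}{i}$ possible compositions of $i$ copies of $\sigma$ and $m-i$ copies of $\delta$ in arbitrary order, and $\pi_i^m=0$ if $i>m$. An ideal $I$ of $R$ is $\sigma$-$\delta$-invariant if $\sigma(I)\subseteq I$ and $\delta(I)\subseteq I$. $R$ is $\sigma$-$\delta$-simple if $\{0\}$ and $R$ are the only $\sigma$-$\delta$-invariant ideals of $R$. *)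

(* Defs.v *)
From HB Require Import structures.
From mathcomp Require Import all_boot all_algebra finmap.
From mathcomp.multinomials Require Import monalg.

Set Implicit Arguments.
Unset Strict Implicit.
Unset Printing Implicit Defensive.

Import GRing.Theory.

Local Open Scope ring_scope.
Local Open Scope group_scope.
Local Open Scope fset_scope.

(* [*] and [1] of group_scope are the operations of the unital magma; no
   associativity is assumed.  [GRing.mul] and [GRing.one] are not used, since
   they belong to associative rings. *)
HB.mixin Record UMagma_Zmodule_isNonAssocRing R
    of GRing.Zmodule R & UMagma R := {
  namulDl : left_distributive ( *%g : R -> R -> R) +%R;
  namulDr : right_distributive ( *%g : R -> R -> R) +%R
}.

#[short(type="nonAssocRingType")]
HB.structure Definition NonAssocRing :=
  {R of GRing.Zmodule R & UMagma R & UMagma_Zmodule_isNonAssocRing R}.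

Section NonAssocRingTheory.
Context (R : nonAssocRingType).
Implicit Types a b : R.

Lemma namul0 b : 0%R * b = 0%R.
Proof. by apply: (addrI (0%R * b)); rewrite -namulDl !addr0. Qed.

Lemma namulr0 a : a * 0%R = 0%R.
Proof. by apply: (addrI (a * 0%R)); rewrite -namulDr !addr0. Qed.

End NonAssocRingTheory.

Record is_ideal (R : nonAssocRingType) (I : R -> Prop) : Prop := IsIdeal {
  ideal0 : I 0%R;
  idealB : forall a b, I a -> I b -> I (a - b)%R;
  idealMl : forall r a, I a -> I (r * a);
  idealMr : forall r a, I a -> I (a * r)
}.

(* The zero ring counts as simple. *)
Definition is_simple (R : nonAssocRingType) : Prop :=
  forall I : R -> Prop, is_ideal I ->
    (forall x, I x <-> x = 0%R) \/ (forall x, I x).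

Definition sd_invariant (R : nonAssocRingType) (sigma delta : R -> R)
    (I : R -> Prop) : Prop :=
  (forall a, I a -> I (sigma a)) /\ (forall a, I a -> I (delta a)).

Definition sd_simple (R : nonAssocRingType) (sigma delta : R -> R) : Prop :=
  forall I : R -> Prop, is_ideal I -> sd_invariant sigma delta I ->
    (forall x, I x <-> x = 0%R) \/ (forall x, I x).

(* The composition encoded by a word, [true] standing for [sigma]. *)
Definition word_comp (R : Type) (sigma delta : R -> R) (w : seq bool) : R -> R :=
  foldr (fun b f => (if b then sigma else delta) \o f) id w.

(* [ore_pi sigma delta m i b] is $\pi_i^m(b)$; the sum is empty if [m < i]. *)
Definition ore_pi (R : zmodType) (sigma delta : R -> R) (m i : nat) (b : R) : R :=
  (\sum_(w : m.-tuple bool | count_mem true w == i)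
     word_comp sigma delta w b)%R.

(* A polynomial is a finitely supported function from exponents to
   coefficients, [<< r *g n >>] being $rX^n$.  The two proofs are parameters
   so that the ring structure, whose unit needs them, attaches to the type. *)
Definition ore_poly (R : nonAssocRingType) (sigma delta : {additive R -> R})
    (sigma1 : sigma 1%g = 1%g) (delta1 : delta 1%g = 0%R) : Type :=
  {malg R[nat]}.

Section OrePoly.
Context (R : nonAssocRingType) (sigma delta : {additive R -> R}).
Implicit Types (a b : R) (m n i : nat) (p q : {malg R[nat]}).

(* $aX^m\cdot bX^n$; the terms with [m < i] vanish. *)
Definition ore_mulU a m b n : {malg R[nat]} :=
  (\sum_(i < m.+1) << (a * ore_pi sigma delta m i b)%g *g (i + n)%N >>)%R.

Definition ore_mul p q : {malg R[nat]} :=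
  (\sum_(m <- msupp p) \sum_(n <- msupp q) ore_mulU p@_m m q@_n n)%R.

Definition ore_one : {malg R[nat]} := << (1%g : R) *g 0%N >>%R.

Lemma word_comp_cons c w b :
  word_comp sigma delta (c :: w) b =
    (if c then sigma else delta : R -> R) (word_comp sigma delta w b).
Proof. by case: c. Qed.

Lemma word_compD w : {morph word_comp sigma delta w : a b / (a + b)%R}.
Proof. by elim: w => // c w IH a b; rewrite !word_comp_cons IH; case: c; rewrite raddfD. Qed.

Lemma ore_piD m i : {morph ore_pi sigma delta m i : a b / (a + b)%R}.
Proof.
move=> a b; rewrite /ore_pi -big_split /=; apply: eq_bigr => w _.
exact: word_compD.
Qed.

Lemma ore_pi0 m i : ore_pi sigma delta m i 0%R = 0%R.
Proof. by apply: (addrI (ore_pi sigma delta m i 0%R)); rewrite -ore_piD !addr0. Qed.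

Lemma ore_pi00 b : ore_pi sigma delta 0 0 b = b.
Proof.
rewrite /ore_pi (big_pred1 [tuple]) // => w.
by rewrite tuple0; apply/esym/eqP.
Qed.

Lemma ore_mulUDl m b n : {morph (fun a => ore_mulU a m b n) : a a' / (a + a')%R}.
Proof.
move=> a a'; rewrite /ore_mulU -big_split /=; apply: eq_bigr => i _.
by rewrite namulDl monalgUD.
Qed.

Lemma ore_mulUDr a m n : {morph (fun b => ore_mulU a m b n) : b b' / (b + b')%R}.
Proof.
move=> b b'; rewrite /ore_mulU -big_split /=; apply: eq_bigr => i _.
by rewrite ore_piD namulDr monalgUD.
Qed.

Lemma ore_mulU0l m b n : ore_mulU 0%R m b n = 0%R.
Proof. by rewrite /ore_mulU big1 // => i _; rewrite namul0 monalgU0. Qed.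

Lemma ore_mulU0r a m n : ore_mulU a m 0%R n = 0%R.
Proof. by rewrite /ore_mulU big1 // => i _; rewrite ore_pi0 namulr0 monalgU0. Qed.

Lemma ore_mulw (d1 d2 : {fset nat}) p q :
  msupp p `<=` d1 -> msupp q `<=` d2 ->
  ore_mul p q = (\sum_(m <- d1) \sum_(n <- d2) ore_mulU p@_m m q@_n n)%R.
Proof.
move=> le_d1 le_d2; rewrite /ore_mul (big_fset_incl _ le_d1) /=.
  apply/eq_bigr=> m _; apply/big_fset_incl => // n _ /mcoeff_outdom ->.
  exact: ore_mulU0r.
move=> m _ /mcoeff_outdom pm0; rewrite big1 // => n _.
by rewrite pm0 ore_mulU0l.
Qed.

Lemma ore_mulDl : left_distributive ore_mul +%R.
Proof.
move=> p p' q.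
rewrite (ore_mulw (msuppD_le p p') (fsubset_refl _)).
rewrite (ore_mulw (fsubsetUl _ (msupp p')) (fsubset_refl _)).
rewrite (ore_mulw (fsubsetUr (msupp p) _) (fsubset_refl _)).
rewrite -big_split /=; apply: eq_bigr => m _.
rewrite -big_split /=; apply: eq_bigr => n _.
by rewrite mcoeffD ore_mulUDl.
Qed.

Lemma ore_mulDr : right_distributive ore_mul +%R.
Proof.
move=> p q q'.
rewrite (ore_mulw (fsubset_refl _) (msuppD_le q q')).
rewrite (ore_mulw (fsubset_refl _) (fsubsetUl _ (msupp q'))).
rewrite (ore_mulw (fsubset_refl _) (fsubsetUr (msupp q) _)).
rewrite -big_split /=; apply: eq_bigr => m _.
rewrite -big_split /=; apply: eq_bigr => n _.
by rewrite mcoeffD ore_mulUDr.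
Qed.

Lemma ore_mulUU a m b n :
  ore_mul << a *g m >>%R << b *g n >>%R = ore_mulU a m b n.
Proof. by rewrite (ore_mulw msuppU_le msuppU_le) !big_seq_fset1 !mcoeffUU. Qed.

Lemma ore_mul1p : left_id ore_one ore_mul.
Proof.
move=> p; rewrite (ore_mulw msuppU_le (fsubset_refl _)) big_seq_fset1 mcoeffUU.
rewrite [RHS]monalgE; apply: eq_bigr => n _.
by rewrite /ore_mulU big_ord1 ore_pi00 mul1g.
Qed.

Hypotheses (sigma1 : sigma 1%g = 1%g) (delta1 : delta 1%g = 0%R).

Lemma word_comp1 w :
  word_comp sigma delta w 1 = if all id w then 1 else 0%R.
Proof.
elim: w => // c w IH; rewrite word_comp_cons IH; case: c => /=; last first.
  by case: ifP => _; rewrite ?delta1 ?raddf0.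
by case: ifP => _; rewrite ?sigma1 ?raddf0.
Qed.

Lemma ore_pi1 m i : ore_pi sigma delta m i 1%g = if i == m then 1 else 0%R.
Proof.
have allE (w : m.-tuple bool) : all id w = (count_mem true w == m).
  rewrite -[m in _ == m](size_tuple w) -all_count.
  by apply: eq_all => -[].
case: eqP => [->|im]; last first.
  rewrite /ore_pi big1 // => w /eqP wi; rewrite word_comp1 allE wi.
  by case: eqP.
rewrite /ore_pi (big_pred1 (nseq_tuple m true)) => [|w].
  by rewrite word_comp1 allE /= count_nseq mul1n eqxx.
apply/idP/eqP => [|->]; last by rewrite /= count_nseq mul1n.
rewrite -allE => wT; apply: val_inj => /=.
rewrite -[X in nseq X](size_tuple w); apply/all_pred1P.
by apply: sub_all wT => -[].
Qed.

Lemma ore_mulp1 : right_id ore_one ore_mul.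
Proof.
move=> p; rewrite (ore_mulw (fsubset_refl _) msuppU_le) [RHS]monalgE.
apply: eq_bigr => m _; rewrite big_seq_fset1 mcoeffUU /ore_mulU.
rewrite big_ord_recr big1 /= => [|i _].
  by rewrite add0r ore_pi1 eqxx mulg1 addn0.
by rewrite ore_pi1 ltn_eqF ?ltn_ord // namulr0 monalgU0.
Qed.

End OrePoly.

Section OrePolyRing.
Context (R : nonAssocRingType) (sigma delta : {additive R -> R}).
Context (sigma1 : sigma 1%g = 1%g) (delta1 : delta 1%g = 0%R).
Local Notation S := (ore_poly sigma1 delta1).

HB.instance Definition _ := GRing.Zmodule.copy S {malg R[nat]}.
HB.instance Definition _ := hasMul.Build S (ore_mul sigma delta).
HB.instance Definition _ := Magma_isUMagma.Build S
  (ore_mul1p sigma delta) (ore_mulp1 sigma1 delta1).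
HB.instance Definition _ := UMagma_Zmodule_isNonAssocRing.Build S
  (ore_mulDl sigma delta) (ore_mulDr sigma delta).

End OrePolyRing.

(* Main.v *)
Require Import Defs.
From HB Require Import structures.
From mathcomp Require Import all_boot all_algebra finmap.
From mathcomp.multinomials Require Import monalg.

Local Open Scope ring_scope.

(** An invariant ideal [I] of [R] extends to the set [coef_in I] of the
    polynomials in [S = R[X; sigma, delta]] all of whose coefficients lie in
    [I].  By biadditivity, only the products of monomials matter for this to be
    an ideal of [S], and the coefficients [a * pi_i^m(b)] of such a product lie
    in [I] as soon as [a] does (because [I] is a right ideal) or [b] does
    (because [I] is a left ideal, stable under [pi_i^m] by invariance).  This is
    [coef_in_ideal].  The constants in [coef_in I] are exactly the elements of
    [I], so [I] is zero if [coef_in I] is zero, and all of [R] if [coef_in I]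
    is all of [S]. *)

Definition coef_in {R : nonAssocRingType} (I : R -> Prop) (p : {malg R[nat]}) :
  Prop := forall k, I p@_k.

Section InvariantIdeals.
Context {R : nonAssocRingType} {I : R -> Prop} (idI : is_ideal I).

Lemma idealD a b : I a -> I b -> I (a + b).
Proof.
move=> Ia Ib; rewrite -[b]GRing.opprK -[- b]GRing.add0r.
by apply: (idealB idI) => //; apply: (idealB idI) => //; exact: (ideal0 idI).
Qed.

Lemma ideal_sum (J : Type) (r : seq J) (P : pred J) (F : J -> R) :
  (forall j, P j -> I (F j)) -> I (\sum_(j <- r | P j) F j).
Proof. exact: (big_ind I (ideal0 idI) idealD). Qed.

Lemma coef_in_sum (J : Type) (r : seq J) (F : J -> {malg R[nat]}) :
  (forall j, coef_in I (F j)) -> coef_in I (\sum_(j <- r) F j).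
Proof.
move=> IF k.
by rewrite GRing.raddf_sum; apply: ideal_sum => j _; exact: IF.
Qed.

Lemma coef_in_monomial a n : I a -> coef_in I << a *g n >>.
Proof.
move=> Ia k; rewrite mcoeffU.
by case: (_ == _) => //; exact: (ideal0 idI).
Qed.

Context {sigma delta : {additive R -> R}}.

Lemma coef_in_mulr p q : coef_in I p -> coef_in I (ore_mul sigma delta p q).
Proof.
move=> Ip; apply: coef_in_sum => m; apply: coef_in_sum => n.
by apply: coef_in_sum => i; apply: coef_in_monomial; apply: (Defs.idealMr idI).
Qed.

Hypothesis invI : sd_invariant sigma delta I.

Lemma ideal_ore_pi m i b : I b -> I (ore_pi sigma delta m i b).
Proof.
move=> Ib; apply: ideal_sum => w _; elim: (tval w) => //= c s IHs.
by case: c; [apply: invI.1 | apply: invI.2].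
Qed.

Lemma coef_in_mull p q : coef_in I q -> coef_in I (ore_mul sigma delta p q).
Proof.
move=> Iq; apply: coef_in_sum => m; apply: coef_in_sum => n.
apply: coef_in_sum => i; apply: coef_in_monomial; apply: (Defs.idealMl idI).
exact: ideal_ore_pi.
Qed.

Lemma coef_in_ideal (sigma1 : sigma 1%g = 1%g) (delta1 : delta 1%g = 0) :
  is_ideal (R := ore_poly sigma1 delta1) (coef_in I).
Proof.
split=> [k | p q Ip Iq k | p q | p q].
- by rewrite mcoeff0; exact: (ideal0 idI).
- by rewrite mcoeffB; apply: (idealB idI).
- exact: coef_in_mull.
- exact: coef_in_mulr.
Qed.

End InvariantIdeals.

Theorem proposition21 (R : nonAssocRingType) (sigma delta : {additive R -> R})
    (sigma1 : sigma 1%g = 1%g) (delta1 : delta 1%g = 0) :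
  is_simple (ore_poly sigma1 delta1) -> sd_simple sigma delta.
Proof.
move=> simpleS I idI invI.
have [S0 | ST] := simpleS _ (coef_in_ideal idI invI sigma1 delta1).
  left=> x; split=> [Ix | ->]; last exact: (ideal0 idI).
  have /S0 x0 : coef_in I << x *g 0%N >> by exact: coef_in_monomial.
  by rewrite -[x](mcoeffUU (G := R) 0%N) x0 mcoeff0.
by right=> x; rewrite -[x](mcoeffUU (G := R) 0%N); apply: ST.
Qed.
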